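(* Let $m\ge1$, $0<q<1$. On the span of the monomial spinors $z^\alpha w^\beta e_S$ with $(\alpha,S)\ne(0,\varnothing)$, the $\mathcal D_q$-complex is contracted by $\mathcal ZA_q^\#$, i.e. $\mathcal D_q\mathcal ZA_q^\#+\mathcal ZA_q^\#\mathcal D_q=I$ there. On the span of those with $(\beta,S)\ne(0,\{1,\dots,m\})$, the $\mathcal D_q^\dagger$-complex is contracted by $\mathcal Z^\dagger B_q^\#$, i.e. $\mathcal D_q^\dagger\mathcal Z^\dagger B_q^\#+\mathcal Z^\dagger B_q^\#\mathcal D_q^\dagger=I$ there. Consequently the cohomologies are $$H(\mathscr P_m,\mathcal D_q)=\ker\mathcal D_q/\operatorname{im}\mathcal D_q\simeq\mathbb C[w_1,\dots,w_m]e_\varnothing,\qquad H(\mathscr P_m,\mathcal D_q^\dagger)=\ker\mathcal D_q^\dagger/\operatorname{im}\mathcal D_q^\dagger\simeq\mathbb C[z_1,\dots,z_m]e_{\{1,\dots,m\}}.$$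
   Context: $[r]_q=\frac{1-q^r}{1-q}$. $\mathscr P_m=\mathbb C[z_1,\dots,z_m,w_1,\dots,w_m]\otimes\bigwedge\mathbb C^m$ with basis $z^\alpha w^\beta e_S$ ($\alpha,\beta\in\mathbb N_0^m$, $S\subseteq\{1,\dots,m\}$). $D_{q,x}f=\frac{f(\dots,qx,\dots)-f(\dots,x,\dots)}{(q-1)x}$; $\varepsilon_i$ is exterior multiplication by the $i$-th basis vector, $\iota_i=\varepsilon_i^*$ contraction. $\mathcal D_q=\sum_i\varepsilon_iD_{q,z_i}$, $\mathcal D_q^\dagger=\sum_i\iota_iD_{q,w_i}$, $\mathcal Z=\sum_i\iota_iz_i$, $\mathcal Z^\dagger=\sum_i\varepsilon_iw_i$; $\mathcal D_q^2=(\mathcal D_q^\dagger)^2=0$. The operators $A_q=\mathcal D_q\mathcal Z+\mathcal Z\mathcal D_q$ and $B_q=\mathcal D_q^\dagger\mathcal Z^\dagger+\mathcal Z^\dagger\mathcal D_q^\dagger$ are diagonal in this basis with eigenvalues $\sum_i[\alpha_i+\mathbf 1_{i\in S}]_q$ and $\sum_i[\beta_i+1-\mathbf 1_{i\in S}]_q$; $A_q^\#,B_q^\#$ are the diagonal generalized inverses obtained by inverting every positive eigenvalue and keeping eigenvalue zero as zero. *)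

(* Defs.v *)
From HB Require Import structures.
From mathcomp Require Import all_boot all_order all_algebra.
From mathcomp Require Import boolp reals complex mpoly.
From mathcomp Require Import ring.

Set Implicit Arguments.
Unset Strict Implicit.
Unset Printing Implicit Defensive.

Import Order.TTheory GRing.Theory Num.Theory.
Local Open Scope ring_scope.
Local Open Scope quotient_scope.

Section LinearSpan.
Variables (K : pzRingType) (V : lmodType K).

Definition lspan (X : V -> Prop) : V -> Prop :=
  fun v => exists s : seq (K * V),
    (forall p, p \in s -> X p.2) /\ v = \sum_(p <- s) p.1 *: p.2.

(* [h] is a contracting homotopy of the subcomplex [U] of [(V, d)]. *)
Definition contracts_on (U : V -> Prop) (d h : V -> V) : Prop :=
  [/\ forall u, U u -> U (d u),
      forall u, U u -> U (h u) &
      forall u, U u -> d (h u) + h (d u) = u].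

End LinearSpan.

Section KernelRange.
Variables (K : pzRingType) (W V : lmodType K) (f : {linear W -> V}).

Definition in_lker : W -> bool := fun u => f u == 0.

Definition in_lrange : V -> bool := fun v => `[< exists u, v = f u >].

Lemma in_lker_closed : subsemimod_closed in_lker.
Proof.
split; first split.
- by rewrite unfold_in /in_lker raddf0.
- move=> u v; rewrite !unfold_in /in_lker => /eqP fu /eqP fv.
  by rewrite linearD fu fv addr0.
- by move=> a u; rewrite !unfold_in /in_lker => /eqP fu; rewrite linearZ /= fu scaler0.
Qed.

Lemma in_lrange_closed : subsemimod_closed in_lrange.
Proof.
split; first split.
- by rewrite !unfold_in; apply/asboolP; exists 0; rewrite raddf0.
- move=> u v; rewrite !unfold_in => /asboolP[x ->] /asboolP[y ->].
  by apply/asboolP; exists (x + y); rewrite raddfD.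
- move=> a u; rewrite !unfold_in => /asboolP[x ->].
  by apply/asboolP; exists (a *: x); rewrite linearZ.
Qed.

HB.instance Definition _ := GRing.isSubmodClosed.Build K W in_lker in_lker_closed.
HB.instance Definition _ :=
  GRing.isSubmodClosed.Build K V in_lrange in_lrange_closed.

Record lker := LKer { lker_val :> W; lker_valP : lker_val \in in_lker }.
HB.instance Definition _ := [isSub for lker_val].
HB.instance Definition _ := [Choice of lker by <:].
HB.instance Definition _ := [SubChoice_isSubLmodule of lker by <:].

Record lrange := LRange { lrange_val :> V; lrange_valP : lrange_val \in in_lrange }.
HB.instance Definition _ := [isSub for lrange_val].
HB.instance Definition _ := [Choice of lrange by <:].
HB.instance Definition _ := [SubChoice_isSubLmodule of lrange by <:].

End KernelRange.

Section Cohomology.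
Variables (K : pzRingType) (V : lmodType K) (d : {linear V -> V}).

Definition coboundary : lker d -> bool := fun c => val c \in in_lrange d.

Lemma coboundary_closed : zmod_closed coboundary.
Proof.
split=> [|u v]; rewrite /in_mem /= /coboundary; first exact: rpred0.
by move=> du dv; rewrite GRing.valB; apply: rpredB.
Qed.

HB.instance Definition _ :=
  GRing.isZmodClosed.Build (lker d) coboundary coboundary_closed.

(* ker d / im d, where im d stands for ker d :&: im d; the two agree as soon
   as d \o d = 0. *)
Definition cohomology :=
  @Quotient.quot (lker d) (GRing.ZmodClosed.clone (lker d) coboundary _).
HB.instance Definition _ := GRing.Zmodule.on cohomology.
HB.instance Definition _ := EqQuotient.on cohomology.

Definition cohomology_scale (a : K) : cohomology -> cohomology :=
  lift_op1 cohomology ( *:%R a).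

Lemma pi_cohomology_scale a :
  {morph \pi_cohomology : x / a *: x >-> cohomology_scale a x}.
Proof.
move=> x; unlock cohomology_scale; apply/eqP.
rewrite -Quotient.idealrBE unfold_in /coboundary -scalerBr linearZ /=.
by apply: rpredZ; have := @Quotient.idealrBE (lker d)
  (GRing.ZmodClosed.clone (lker d) coboundary _) x (repr (\pi_cohomology x));
  rewrite reprK eqxx.
Qed.

Fact cohomology_scaleA a b u :
  cohomology_scale a (cohomology_scale b u) = cohomology_scale (a * b) u.
Proof. by rewrite -[u]reprK -!pi_cohomology_scale scalerA. Qed.

Fact cohomology_scale1 : left_id 1 cohomology_scale.
Proof. by move=> u; rewrite -[u]reprK -!pi_cohomology_scale scale1r. Qed.

Fact cohomology_scaleDr : right_distributive cohomology_scale +%R.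
Proof.
move=> a u v; rewrite -[u]reprK -[v]reprK.
by rewrite -raddfD -!pi_cohomology_scale scalerDr raddfD.
Qed.

Fact cohomology_scaleDl u : {morph cohomology_scale^~ u : a b / a + b}.
Proof.
by move=> a b; rewrite /= -[u]reprK -!pi_cohomology_scale scalerDl raddfD.
Qed.

HB.instance Definition _ := GRing.Zmodule_isLmodule.Build K cohomology
  cohomology_scaleA cohomology_scale1 cohomology_scaleDr cohomology_scaleDl.

End Cohomology.

(* The subspace im f consists of cocycles of d, and u |-> [u] is a linear
   isomorphism from im f onto ker d / im d. *)
Definition represents_cohomology (K : pzRingType) (W V : lmodType K)
    (f : {linear W -> V}) (d : {linear V -> V}) : Prop :=
  exists phi : {linear lrange f -> cohomology d},
    bijective phi /\
    forall u, exists2 c : lker d,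
      lker_val c = lrange_val u & phi u = \pi_(cohomology d) c.

Section QDerivative.
Variables (K : fieldType) (n : nat).
Implicit Types (q : K) (i : 'I_n) (p : {mpoly K[n]}).

Definition qnum q (r : nat) : K := (1 - q ^+ r) / (1 - q).

Definition mdil q i p : {mpoly K[n]} :=
  p \mPo [tuple (if j == i then q *: 'X_j else 'X_j) | j < n].

(* Division by 'X_i, dropping the monomials that 'X_i does not divide. *)
Definition mdivX i p : {mpoly K[n]} :=
  \sum_(a <- msupp p | (0 < a i)%N) p@_a *: 'X_[a - U_(i)].

Definition qderiv q i p : {mpoly K[n]} :=
  (q - 1)^-1 *: mdivX i (mdil q i p - p).

Lemma mcoeff_mdil q i p a : (mdil q i p)@_a = q ^+ a i * p@_a.
Proof.
have mdilX b : mdil q i 'X_[b] = q ^+ b i *: 'X_[b].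
  rewrite /mdil comp_mpolyX [in RHS]mpolyXE_id.
  rewrite (bigD1 i) //= tnth_mktuple eqxx exprZn -scalerAl; congr (_ *: _).
  rewrite [in RHS](bigD1 i) //=; congr (_ * _).
  by apply: eq_bigr => j /negPf ji; rewrite tnth_mktuple ji.
rewrite /mdil comp_mpolyEX raddf_sum /=.
rewrite [in RHS](mpolyE p) raddf_sum mulr_sumr /=; apply: eq_bigr => b _.
rewrite -/(mdil q i 'X_[b]) mdilX !mcoeffZ mcoeffX.
by case: eqP => [->|]; rewrite ?mulr0 // mulr1 mulrC mulr1.
Qed.

Lemma mcoeff_mdivX i p a : (mdivX i p)@_a = p@_(a + U_(i)).
Proof.
rewrite /mdivX raddf_sum /=.
have eqa (b : 'X_{1..n}) : (0 < b i)%N ->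
    ((b - U_(i))%MM == a) = (b == (a + U_(i))%MM).
  move=> bi; apply/eqP/eqP => [<-|->]; last by rewrite addmK.
  rewrite submK //; apply/mnm_lepP => j; rewrite mnm1E.
  by case: eqP => // <-.
transitivity (\sum_(b <- msupp p) p@_b * (b == (a + U_(i))%MM)%:R).
  rewrite [RHS](bigID (fun b : 'X_{1..n} => (0 < b i)%N)) /=.
  rewrite [X in _ + X]big1 ?addr0 => [|b].
    by apply: eq_bigr => b bi; rewrite mcoeffZ mcoeffX eqa.
  rewrite -eqn0Ngt => /eqP bi; case: eqP => [Eb|_]; last by rewrite mulr0.
  by move: bi; rewrite Eb mnmDE mnm1E eqxx addn1.
rewrite [in RHS](mpolyE p) raddf_sum /=.
by apply: eq_bigr => b _; rewrite mcoeffZ mcoeffX.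
Qed.

Lemma qderiv_is_linear q i : linear (qderiv q i).
Proof.
move=> c p r; apply/mpolyP => a; rewrite /qderiv.
rewrite !(mcoeffD, mcoeffZ, mcoeff_mdivX, mcoeffN, mcoeff_mdil).
ring.
Qed.
HB.instance Definition _ q i :=
  GRing.isLinear.Build K {mpoly K[n]} {mpoly K[n]} _ (qderiv q i)
    (qderiv_is_linear q i).

Lemma qderivP q i p :
  q != 1 -> (q - 1) *: ('X_i * qderiv q i p) = mdil q i p - p.
Proof.
move=> q1; rewrite -scalerAr scalerA divff ?subr_eq0 // scale1r.
apply/mpolyP => a; rewrite mulrC.
have [ai|ai] := posnP (a i).
  rewrite mcoeffB mcoeff_mdil ai expr0 mul1r subrr.
  rewrite [LHS]mcoeffMr big1 // => -[b c] /= /eqP Ea.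
  rewrite mcoeffX; case: eqP => [Eb|_]; last by rewrite mulr0.
  have /(congr1 (fun x : 'X_{1..n} => x i)) := Ea.
  by rewrite /= ai mnmDE -Eb mnm1E eqxx ?addn1 ?add1n.
have {1}-> : a = (U_(i) + (a - U_(i)))%MM.
  by rewrite addmC submK //; apply/mnm_lepP => j; rewrite mnm1E; case: eqP => // <-.
rewrite mcoeffMX mcoeff_mdivX submK //.
by apply/mnm_lepP => j; rewrite mnm1E; case: eqP => // <-.
Qed.

Lemma qderivX q i a :
  q != 1 -> qderiv q i 'X_[a] = qnum q (a i) *: 'X_[a - U_(i)].
Proof.
move=> q1; apply/mpolyP => b.
rewrite /qderiv mcoeffZ mcoeff_mdivX mcoeffB mcoeff_mdil mcoeffZ !mcoeffX.
have [ai|ai] := posnP (a i).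
  rewrite ai /qnum expr0 subrr !mul0r; case: eqP => [Ea|_]; last by rewrite !mulr0 subr0 mulr0.
  by move: ai; rewrite Ea mnmDE mnm1E eqxx addn1.
have -> : (a == (b + U_(i))%MM) = ((a - U_(i))%MM == b).
  apply/eqP/eqP => [->|<-]; first by rewrite addmK.
  by rewrite submK //; apply/mnm_lepP => j; rewrite mnm1E; case: eqP => // <-.
case: eqP => [<-|_]; last by rewrite !mulr0 subr0 mulr0.
rewrite submK; last by apply/mnm_lepP => j; rewrite mnm1E; case: eqP => // <-.
rewrite /qnum !mulr1 -[1 - _]opprB -[1 - q]opprB invrN mulrNN mulrC //.
Qed.

End QDerivative.

(* A spinor [u] is stored by its components: it stands for the sum over S of
   u S (x) e_S.  The variable z_i is 'X_(lshift m i), and w_i is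
   'X_(rshift m i). *)
Notation spinor K m := {ffun {set 'I_m} -> {mpoly K[m + m]}}.

Section Spinors.
Variables (K : fieldType) (m : nat).
Implicit Types (u v : spinor K m) (S T : {set 'I_m}) (i j : 'I_m) (q : K).

Definition tens (p : {mpoly K[m + m]}) S : spinor K m :=
  [ffun T : {set 'I_m} => p *+ (T == S)].

Definition zwe (a b : 'X_{1..m}) S : spinor K m :=
  tens ((\prod_i 'X_(lshift m i) ^+ a i) * (\prod_i 'X_(rshift m i) ^+ b i)) S.

(* The sign in e_i /\ e_S = wedge_sign i S e_(i |: S), for i \notin S. *)
Definition wedge_sign i S : K := (-1) ^+ #|[set j in S | (j < i)%N]|.

Definition wedge i u : spinor K m :=
  [ffun T : {set 'I_m} => if i \in T then wedge_sign i T *: u (T :\ i) else 0].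

Definition contr i u : spinor K m :=
  [ffun T : {set 'I_m} => if i \in T then 0 else wedge_sign i T *: u (i |: T)].

(* The action of f (x) id. *)
Definition act (f : {mpoly K[m + m]} -> {mpoly K[m + m]}) u : spinor K m :=
  [ffun T : {set 'I_m} => f (u T)].

Definition mulX (x : 'I_(m + m)) : {mpoly K[m + m]} -> {mpoly K[m + m]} :=
  fun p => 'X_x * p.

Definition Dq q u := \sum_i wedge i (act (qderiv q (lshift m i)) u).
Definition Dqd q u := \sum_i contr i (act (qderiv q (rshift m i)) u).
Definition Zop u := \sum_i contr i (act (mulX (lshift m i)) u).
Definition Zopd u := \sum_i wedge i (act (mulX (rshift m i)) u).
Definition Aq q u := Dq q (Zop u) + Zop (Dq q u).
Definition Bq q u := Dqd q (Zopd u) + Zopd (Dqd q u).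

Lemma mulX_is_linear x : linear (mulX x).
Proof. by move=> a p r; rewrite /mulX mulrDr scalerAr. Qed.
HB.instance Definition _ x :=
  GRing.isLinear.Build K {mpoly K[m + m]} {mpoly K[m + m]} _ (mulX x)
    (mulX_is_linear x).

Lemma wedge_tens i p S :
  wedge i (tens p S) = if i \in S then 0 else wedge_sign i S *: tens p (i |: S).
Proof.
apply/ffunP => T; rewrite !ffunE; case: ifPn => iT.
  have -> : wedge_sign i T = wedge_sign i (T :\ i).
    congr (_ ^+ #|pred_of_set _|); apply/setP => j; rewrite !inE.
    by case: eqP => // ->; rewrite ltnn andbF.
  case: ifPn => iS; rewrite !ffunE.
    by case: eqP => [E|_]; rewrite ?scaler0 //; move: iS; rewrite -E !inE eqxx.
  case: (T =P i |: S) => [->|NE]; first by rewrite setU1K // eqxx.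
  by case: eqP => [E|_]; rewrite ?scaler0 //; case: NE; rewrite -E setD1K.
case: ifPn => iS; rewrite !ffunE //.
by case: eqP => [E|_]; rewrite ?scaler0 //; move: iT; rewrite E !inE eqxx.
Qed.

Lemma contr_adjoint i p S T : contr i (tens p S) T = wedge i (tens p T) S.
Proof.
rewrite wedge_tens !ffunE; case: ifPn => iT; rewrite !ffunE //.
by rewrite [_ == S]eq_sym.
Qed.

Lemma act_is_linear (f : {linear {mpoly K[m + m]} -> {mpoly K[m + m]}}) :
  linear (act f).
Proof. by move=> a u v; apply/ffunP => T; rewrite !ffunE linearP. Qed.
HB.instance Definition _ (f : {linear {mpoly K[m + m]} -> {mpoly K[m + m]}}) :=
  GRing.isLinear.Build K (spinor K m) (spinor K m) _ (act f) (act_is_linear f).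

Lemma wedge_is_linear i : linear (wedge i).
Proof.
move=> a u v; apply/ffunP => T; rewrite !ffunE.
by case: ifP => _; rewrite ?scaler0 ?addr0 // scalerDr !scalerA mulrC.
Qed.
HB.instance Definition _ i :=
  GRing.isLinear.Build K (spinor K m) (spinor K m) _ (wedge i) (wedge_is_linear i).

Lemma contr_is_linear i : linear (contr i).
Proof.
move=> a u v; apply/ffunP => T; rewrite !ffunE.
by case: ifP => _; rewrite ?scaler0 ?addr0 // scalerDr !scalerA mulrC.
Qed.
HB.instance Definition _ i :=
  GRing.isLinear.Build K (spinor K m) (spinor K m) _ (contr i) (contr_is_linear i).

Lemma Dq_is_linear q : linear (Dq q).
Proof.
move=> a u v; rewrite /Dq scaler_sumr -big_split /=.
by apply: eq_bigr => i _; rewrite !linearP.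
Qed.
HB.instance Definition _ q :=
  GRing.isLinear.Build K (spinor K m) (spinor K m) _ (Dq q) (Dq_is_linear q).

Lemma Dqd_is_linear q : linear (Dqd q).
Proof.
move=> a u v; rewrite /Dqd scaler_sumr -big_split /=.
by apply: eq_bigr => i _; rewrite !linearP.
Qed.
HB.instance Definition _ q :=
  GRing.isLinear.Build K (spinor K m) (spinor K m) _ (Dqd q) (Dqd_is_linear q).

(* p |-> p(w) e_set0, whose range is C[w] e_set0. *)
Definition wvac (p : {mpoly K[m]}) : spinor K m :=
  tens (p \mPo [tuple 'X_(rshift m i) | i < m]) set0.

(* p |-> p(z) e_setT, whose range is C[z] e_setT. *)
Definition ztop (p : {mpoly K[m]}) : spinor K m :=
  tens (p \mPo [tuple 'X_(lshift m i) | i < m]) setT.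

Lemma tens_is_linear S : linear (tens^~ S).
Proof. by move=> a p r; apply/ffunP => T; rewrite !ffunE mulrnDl scalerMnr. Qed.

Lemma wvac_is_linear : linear wvac.
Proof. by move=> a p r; rewrite /wvac linearP tens_is_linear. Qed.
HB.instance Definition _ :=
  GRing.isLinear.Build K {mpoly K[m]} (spinor K m) _ wvac wvac_is_linear.

Lemma ztop_is_linear : linear ztop.
Proof. by move=> a p r; rewrite /ztop linearP tens_is_linear. Qed.
HB.instance Definition _ :=
  GRing.isLinear.Build K {mpoly K[m]} (spinor K m) _ ztop ztop_is_linear.

End Spinors.

Section GeneralizedInverse.
Variables (K : numFieldType) (m : nat).

(* The coefficient of A b on b, for the basis vector b = 'X_[k] (x) e_S. *)
Definition diag_entry (A : spinor K m -> spinor K m) (k : 'X_{1..m + m})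
    (S : {set 'I_m}) : K :=
  (A (tens 'X_[k] S) S)@_k.

Definition diag_ginv (A : spinor K m -> spinor K m) (u : spinor K m) :
    spinor K m :=
  \sum_S \sum_(k <- msupp (u S))
    (if 0 < diag_entry A k S then (diag_entry A k S)^-1 else 0)
      *: ((u S)@_k *: tens 'X_[k] S).

End GeneralizedInverse.

Section Diagonal.
Variables (K : fieldType) (m : nat) (q : K).
Hypothesis q1 : q != 1.
Implicit Types (u : spinor K m) (S T : {set 'I_m}) (i j : 'I_m).

Lemma wedge_signD1 i j T : i \in T ->
  wedge_sign K j T = (-1) ^+ (i < j)%N * wedge_sign K j (T :\ i).
Proof.
move=> iT; rewrite /wedge_sign -exprD (cardsD1 i) !inE iT /=.
by congr (_ ^+ (_ + #|pred_of_set _|)); apply/setP => l; rewrite !inE andbA.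
Qed.

Lemma wedge_sign2 i T : wedge_sign K i T * wedge_sign K i T = 1.
Proof. by rewrite /wedge_sign -expr2 sqrr_sign. Qed.

Lemma wedge_contrE i u T : wedge i (contr i u) T = if i \in T then u T else 0.
Proof.
rewrite !ffunE !inE eqxx /=; case: ifP => // iT.
by rewrite scalerA setD1K // (wedge_signD1 _ iT) ltnn mul1r wedge_sign2 scale1r.
Qed.

Lemma contr_wedgeE i u T : contr i (wedge i u) T = if i \in T then 0 else u T.
Proof.
rewrite !ffunE !inE eqxx /=; case: ifPn => // iT.
have iS : i \in i |: T by rewrite setU11.
by rewrite scalerA (wedge_signD1 _ iS) ltnn mul1r setU1K // wedge_sign2 scale1r.
Qed.

Lemma wedge_contrD i j u : wedge i (contr j u) + contr j (wedge i u) = u *+ (i == j).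
Proof.
apply/ffunP => T; rewrite ffunMnE ffunE.
have [<-|ij] /= := eqVneq i j.
  by rewrite wedge_contrE contr_wedgeE; case: ifP; rewrite ?addr0 ?add0r.
rewrite !ffunE !inE (negPf ij) (eq_sym j i) (negPf ij) /=.
case: (boolP (i \in T)) => iT; case: (boolP (j \in T)) => jT;
  rewrite ?scaler0 ?addr0 //.
rewrite !scalerA (_ : (j |: T) :\ i = j |: (T :\ i)); last first.
  by apply/setP => l; rewrite !inE; case: (eqVneq l j) => // ->; rewrite eq_sym ij.
have jS : j \in j |: T by rewrite setU11.
rewrite (wedge_signD1 j iT) (wedge_signD1 i jS) setU1K // -scalerDl.
rewrite (_ : _ + _ = 0) ?scale0r //.
have: nat_of_ord i != j by [].
case: ltngtP => // _ _; rewrite expr0 expr1; ring.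
Qed.

Lemma act_tens (f : {linear {mpoly K[m + m]} -> {mpoly K[m + m]}}) p S :
  act f (tens p S) = tens (f p) S.
Proof. by apply/ffunP => T; rewrite !ffunE raddfMn. Qed.

Lemma qderivMX x y k : x != y ->
  qderiv q x ('X_y * 'X_[k]) = 'X_y * qderiv q x 'X_[k] :> {mpoly K[m + m]}.
Proof.
move=> xy; rewrite -mpolyXD !qderivX // -scalerAr -mpolyXD mnmDE mnm1E.
rewrite eq_sym (negPf xy) add0n.
have [->|kx] := posnP (k x); first by rewrite /qnum expr0 subrr mul0r !scale0r.
congr (_ *: 'X_[_]); apply/mnmP => z; rewrite !(mnmBE, mnmDE, mnm1E) addnBA //.
by case: eqP => // <-.
Qed.

Lemma qderivMXX x k :
  qderiv q x ('X_x * 'X_[k]) = qnum q (k x).+1 *: 'X_[k] :> {mpoly K[m + m]}.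
Proof.
by rewrite -mpolyXD qderivX // mnmDE mnm1E eqxx add1n addmC addmK.
Qed.

Lemma mulX_qderiv x k :
  'X_x * qderiv q x 'X_[k] = qnum q (k x) *: 'X_[k] :> {mpoly K[m + m]}.
Proof.
rewrite qderivX // -scalerAr -mpolyXD.
have [->|kx] := posnP (k x); first by rewrite /qnum expr0 subrr mul0r !scale0r.
rewrite addmC submK //; apply/mnm_lepP => y; rewrite mnm1E.
by case: eqP => // <-.
Qed.

Lemma act_wedge (f : {linear {mpoly K[m + m]} -> {mpoly K[m + m]}}) i u :
  act f (wedge i u) = wedge i (act f u).
Proof. by apply/ffunP => T; rewrite !ffunE; case: ifP => _; rewrite ?raddf0 ?linearZ. Qed.

Lemma act_contr (f : {linear {mpoly K[m + m]} -> {mpoly K[m + m]}}) i u :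
  act f (contr i u) = contr i (act f u).
Proof. by apply/ffunP => T; rewrite !ffunE; case: ifP => _; rewrite ?raddf0 ?linearZ. Qed.

Lemma Aq_diag (k : 'X_{1..m + m}) S :
  Aq q (tens 'X_[k] S) =
    (\sum_i qnum q (k (lshift m i) + (i \in S))) *: tens 'X_[k] S.
Proof.
rewrite /Aq /Dq /Zop.
under eq_bigr => i _ do rewrite !linear_sum /=.
under [X in _ + X]eq_bigr => j _ do rewrite !linear_sum /=.
rewrite [X in _ + X]exchange_big -big_split scaler_suml /=; apply: eq_bigr => i _.
rewrite -big_split (bigD1 i) //= [X in _ + X]big1 ?addr0 => [|j ji].
  rewrite !(act_wedge, act_contr) !act_tens /= /mulX qderivMXX mulX_qderiv.
  apply/ffunP => T; rewrite ffunE wedge_contrE contr_wedgeE !ffunE.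
  have [->|] := eqVneq T S; last by case: ifP; rewrite !mulr0n !scaler0 addr0.
  by rewrite !mulr1n; case: ifP => _; rewrite ?addn1 ?addn0 ?addr0 ?add0r.
rewrite !(act_wedge, act_contr) !act_tens /= /mulX qderivMX ?wedge_contrD //.
  by rewrite eq_sym (negPf ji) mulr0n.
by apply: contra ji => /eqP/lshift_inj ->.
Qed.

Lemma Bq_diag (k : 'X_{1..m + m}) S :
  Bq q (tens 'X_[k] S) =
    (\sum_i qnum q (k (rshift m i) + (i \notin S))) *: tens 'X_[k] S.
Proof.
rewrite /Bq /Dqd /Zopd.
under eq_bigr => i _ do rewrite !linear_sum /=.
under [X in _ + X]eq_bigr => j _ do rewrite !linear_sum /=.
rewrite [X in _ + X]exchange_big -big_split scaler_suml /=; apply: eq_bigr => i _.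
rewrite -big_split (bigD1 i) //= [X in _ + X]big1 ?addr0 => [|j ji].
  rewrite !(act_wedge, act_contr) !act_tens /= /mulX qderivMXX mulX_qderiv.
  apply/ffunP => T; rewrite ffunE wedge_contrE contr_wedgeE !ffunE.
  have [->|] := eqVneq T S; last by case: ifP; rewrite !mulr0n !scaler0 addr0.
  by rewrite !mulr1n; case: ifP => _; rewrite ?addn1 ?addn0 ?addr0 ?add0r.
rewrite !(act_wedge, act_contr) !act_tens /= /mulX qderivMX; last first.
  by apply: contra ji => /eqP/rshift_inj ->.
by rewrite addrC wedge_contrD (negPf ji) mulr0n.
Qed.

End Diagonal.

(* Main.v *)
(* Let d be either differential, Z the opposite operator, A = d Z + Z d, G the
   generalized inverse of A and P = 1 - A G the projection onto the kernel of A.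
   Since d d = 0, d commutes with A; as moreover P d = d P = 0, it commutes with
   G, and therefore d (Z G) + (Z G) d = A G = 1 - P.  This contracts the kernel
   of P, and makes the range of P, on which d vanishes, a space of
   representatives of the cohomology.  An eigenvalue of A, being a sum of
   nonnegative q-numbers, is zero only when all its terms are, so the range of P
   is spanned by the monomials excluded from the contraction. *)
Require Import Defs.
From HB Require Import structures.
From mathcomp Require Import all_boot all_order all_algebra.
From mathcomp Require Import boolp reals complex mpoly.
From mathcomp Require Import ring zify.

Set Implicit Arguments.
Unset Strict Implicit.
Unset Printing Implicit Defensive.

Import Order.TTheory GRing.Theory Num.Theory.
Local Open Scope ring_scope.
Local Open Scope quotient_scope.

(* Plain [lker] is the kernel of vector.v here. *)
Lemma pi_cohomologyP (K : pzRingType) (V : lmodType K) (d : {linear V -> V})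
    (x y : Defs.lker d) :
  \pi_(cohomology d) x = \pi_(cohomology d) y <->
  exists v, lker_val x - lker_val y = d v.
Proof.
rewrite (rwP eqP) -Quotient.idealrBE unfold_in /coboundary unfold_in.
by rewrite -(rwP (asboolP _)).
Qed.

(** * Contracting homotopies and cohomology from a generalized inverse *)

Section Homotopy.
Variables (K : pzRingType) (V : lmodType K) (d Z : {linear V -> V}) (G P : V -> V).
Hypothesis dd0 : forall u, d (d u) = 0.
Hypothesis AG : forall u, d (Z (G u)) + Z (d (G u)) = u - P u.
Hypothesis GA : forall u, G (d (Z u) + Z (d u)) = u - P u.
Hypothesis Pd0 : forall u, P (d u) = 0.
Hypothesis dP0 : forall u, d (P u) = 0.

(** Both sides equal $G(dZdG\,u)$: the right one because $P$ kills $dG\,u$ and $d^2=0$, the left one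
    because applying $d$ to $AG\,u=u-Pu$ gives $dZdG\,u=du$. *)
Lemma ginv_comm u : G (d u) = d (G u).
Proof.
have := GA (d (G u)); rewrite Pd0 subr0 dd0 linear0 addr0 => <-.
congr G; have := congr1 d (AG u).
by rewrite linearD dd0 add0r linearB /= dP0 subr0 => ->.
Qed.

Lemma ginv_homotopy u : d (Z (G u)) + Z (G (d u)) = u - P u.
Proof. by rewrite ginv_comm AG. Qed.

Lemma contracts_on_ginv (U : V -> Prop) :
    (forall u, U u <-> P u = 0) -> (forall u, P (Z u) = 0) ->
  contracts_on U d (fun u => Z (G u)).
Proof.
move=> UP PZ0; split=> u Uu; try by apply/UP.
by rewrite ginv_homotopy (UP u).1 ?subr0.
Qed.

(** The hypotheses on [f] say that $P$ is a projection with the same range as [f]. Each class then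
    contains exactly one element of that range. *)
Lemma represents_cohomology_ginv (W : lmodType K) (f : {linear W -> V}) :
    (forall p, P (f p) = f p) -> (forall u, P u \in in_lrange f) ->
  represents_cohomology f d.
Proof.
move=> Pf Pran.
have ranP (u : lrange f) : P (lrange_val u) = lrange_val u.
  by case: u => v /= /[!unfold_in] /asboolP[p ->].
have kerP (u : lrange f) : lrange_val u \in in_lker d.
  by rewrite unfold_in /in_lker -ranP dP0.
pose phi (u : lrange f) : cohomology d := \pi_(cohomology d) (LKer (kerP u)).
have phi_lin : linear phi.
  move=> a u v; rewrite /phi.
  have <- : \pi_(cohomology d) (a *: LKer (kerP u)) =
      a *: \pi_(cohomology d) (LKer (kerP u)) := pi_cohomology_scale a _.
  by rewrite -raddfD; congr (\pi_(cohomology d) _); apply: val_inj.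
pose phiL : {linear lrange f -> cohomology d} :=
  HB.pack phi (GRing.isLinear.Build K (lrange f) (cohomology d) _ phi phi_lin).
exists phiL; split; last by move=> u; exists (LKer (kerP u)).
(* A coboundary in the range of [f] is both fixed and killed by [P]. *)
have phi_inj : injective phi.
  move=> u v /pi_cohomologyP[w /= uvw]; apply: val_inj => /=.
  apply/eqP; rewrite -subr_eq0 -[_ - _](ranP (u - v)) /= uvw Pd0 //.
(* The inverse applies $P$ to a representative: a cocycle $w$ satisfies $Pw-w=-d(ZG\,w)$. *)
have phiK : cancel (fun c => LRange (Pran (lker_val (repr c)))) phi.
  move=> c; rewrite -[RHS]reprK; apply/pi_cohomologyP.
  case: (repr c) => w /= w0; exists (- Z (G w)).
  (* [P] and [G] are plain functions here, so their values at 0 are read off [Pd0] and [GA] at 0. *)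
  have P0 : P 0 = 0 by have := Pd0 0; rewrite linear0.
  have G0 : G 0 = 0.
    by have := GA 0; rewrite !linear0 addr0 P0 subr0.
  have := ginv_homotopy w; move: w0; rewrite unfold_in /in_lker => /eqP ->.
  by rewrite G0 linear0 addr0 linearN /= => ->; rewrite opprB.
by exists (fun c => LRange (Pran (lker_val (repr c)))) => //; apply: inj_can_sym.
Qed.

End Homotopy.

(** Exchanging the two sums changes the sign, so twice the sum vanishes, and 2 is invertible. *)
Lemma anticomm_sum_sq0 (K : numFieldType) (V : lmodType K) (I : finType)
    (F : I -> {linear V -> V}) u :
  (forall i j v, F i (F j v) = - F j (F i v)) ->
  \sum_i F i (\sum_j F j u) = 0.
Proof.
move=> FN; set s := \sum_i _.
have sN : s = - s.
  rewrite {1}/s; under eq_bigr do rewrite linear_sum.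
  rewrite exchange_big -sumrN; apply: eq_bigr => i _ /=.
  by rewrite linear_sum -sumrN; apply: eq_bigr => j _; apply: FN.
have : (2 : K) *: s = 0 by rewrite scaler_nat mulr2n {1}sN addNr.
by move/eqP; rewrite scaler_eq0 pnatr_eq0 => /eqP.
Qed.

(** * Positivity of $q$-numbers for $0<q<1$ *)

Section QNumbers.
Variables (K : numFieldType) (q : K).
Hypotheses (q_gt0 : 0 < q) (q_lt1 : q < 1).

Lemma qnum_ge0 r : 0 <= qnum q r.
Proof.
by rewrite divr_ge0 ?subr_ge0 ?(ltW q_lt1) // exprn_ile1 // ltW.
Qed.

Lemma qnum_eq0 r : (qnum q r == 0) = (r == 0)%N.
Proof.
rewrite mulf_eq0 invr_eq0 !subr_eq0 [1 == q]gt_eqF // orbF.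
have [->|r0] := eqVneq r 0%N; first by rewrite expr0 eqxx.
by rewrite gt_eqF // exprn_ilt1 // ltW.
Qed.

End QNumbers.

(** * Operators diagonal in the monomial basis *)

Section DiagonalOperators.
Variables (K : fieldType) (m : nat).
Implicit Types (u : spinor K m) (c : 'X_{1..m + m} -> {set 'I_m} -> K).
Implicit Types (k : 'X_{1..m + m}) (S T : {set 'I_m}).

Lemma spinorP (u v : spinor K m) : (forall k S, (u S)@_k = (v S)@_k) <-> u = v.
Proof.
by split=> [uv|-> //]; apply/ffunP => S; apply/mpolyP => k; apply: uv.
Qed.

Lemma mcoeff_tensX k S l T : (tens 'X_[K, k] S T)@_l = ((k == l) && (T == S))%:R.
Proof. by rewrite ffunE mcoeffMn mcoeffX; case: eqP; case: eqP. Qed.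

(** The summand has the shape of the one in [diag_ginv], so the generalized inverse is an instance
    by conversion. *)
Definition diagop c u : spinor K m :=
  \sum_S \sum_(k <- msupp (u S)) c k S *: ((u S)@_k *: tens 'X_[k] S).

Lemma mcoeff_diagop c u k S : (diagop c u S)@_k = c k S * (u S)@_k.
Proof.
rewrite /diagop sum_ffunE raddf_sum (bigD1 S) //= [X in _ + X]big1 ?addr0 => [|T TS].
  rewrite sum_ffunE raddf_sum [in RHS](mpolyE (u S)) raddf_sum mulr_sumr /=.
  apply: eq_bigr => l _; rewrite !ffunE eqxx mulr1n !mcoeffZ !mcoeffX.
  by case: eqP => [->|]; rewrite ?mulr0.
rewrite sum_ffunE raddf_sum big1 //= => l _.
by rewrite !ffunE [S == T]eq_sym (negPf TS) mulr0n !scaler0 mcoeff0.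
Qed.

Lemma spinor_sumE u :
  u = \sum_S \sum_(k <- msupp (u S)) (u S)@_k *: tens 'X_[k] S.
Proof.
have {1}-> : u = diagop (fun _ _ => 1) u.
  by apply/spinorP => k S; rewrite mcoeff_diagop mul1r.
by apply: eq_bigr => S _; apply: eq_bigr => k _; rewrite scale1r.
Qed.

Lemma diagopE c (A : {linear spinor K m -> spinor K m}) :
  (forall k S, A (tens 'X_[k] S) = c k S *: tens 'X_[k] S) ->
  forall u, A u = diagop c u.
Proof.
move=> Ac u; rewrite {1}[u]spinor_sumE linear_sum; apply: eq_bigr => S _.
rewrite linear_sum; apply: eq_bigr => k _.
by rewrite linearZ /= Ac !scalerA mulrC.
Qed.

Lemma lspan_tensX (bad : 'X_{1..m + m} -> {set 'I_m} -> bool) u :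
  lspan (fun v => exists k S, ~~ bad k S /\ v = tens 'X_[k] S) u <->
  forall k S, bad k S -> (u S)@_k = 0.
Proof.
split=> [[s [sP ->]] k S kS|u0].
  rewrite sum_ffunE raddf_sum big_seq big1 //= => p /sP[l [T [lT ->]]].
  rewrite ffunE mcoeffZ mcoeff_tensX.
  case: eqP => [E|_]; rewrite ?mulr0 //; case: eqP => [E'|_]; rewrite ?mulr0 //.
  by rewrite E -E' kS in lT.
(* The monomial expansion of [u] is the witness: a pair in the support has a nonzero coefficient, so
   it is not bad. *)
exists [seq ((u T)@_k, tens 'X_[k] T) | T <- enum {set 'I_m}, k <- msupp (u T)].
split=> [p /allpairsPdep[S [k [_ kS ->]]]|] /=.
  exists k, S; split=> //; apply/negP => /u0 /eqP.
  by rewrite mcoeff_eq0 kS.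
by rewrite big_allpairs_dep big_enum /= -spinor_sumE.
Qed.

End DiagonalOperators.

(** * The abstract argument for a diagonal $A=dZ+Zd$ *)

Section DiagonalHomotopy.
Variables (K : numFieldType) (m : nat).
Variable lam : 'X_{1..m + m} -> {set 'I_m} -> K.
Variables d Z : {linear spinor K m -> spinor K m}.
Hypothesis lam_ge0 : forall k S, 0 <= lam k S.
Hypothesis dd0 : forall u, d (d u) = 0.
Hypothesis A_lam : forall k S,
  d (Z (tens 'X_[k] S)) + Z (d (tens 'X_[k] S)) = lam k S *: tens 'X_[k] S.
Hypothesis mcoeff_d : forall u k S, lam k S = 0 -> (d u S)@_k = 0.
Hypothesis mcoeff_Z : forall u k S, lam k S = 0 -> (Z u S)@_k = 0.
Hypothesis d_tens : forall k S, lam k S = 0 -> d (tens 'X_[k] S) = 0.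

Let A u := d (Z u) + Z (d u).
(** This 0/1 operator is $1-AG$: an eigenvalue times its generalized inverse is 1 unless the
    eigenvalue is 0. *)
Let P := diagop (fun k S => (lam k S == 0)%:R : K).

Let mcoeffA u k S : (A u S)@_k = lam k S * (u S)@_k.
Proof.
have A_lin : linear A.
  by move=> a v w; rewrite /A !linearP /= scalerDr addrACA.
pose AL : {linear spinor K m -> spinor K m} :=
  HB.pack A (GRing.isLinear.Build _ _ _ _ A A_lin).
by rewrite -[A u]/(AL u) (@diagopE _ _ lam AL A_lam) mcoeff_diagop.
Qed.

Let mcoeffG u k S :
  (diag_ginv A u S)@_k = (if lam k S == 0 then 0 else (lam k S)^-1) * (u S)@_k.
Proof.
rewrite -[diag_ginv A u]/(diagop (fun k S =>
  if 0 < diag_entry A k S then (diag_entry A k S)^-1 else 0) u).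
rewrite mcoeff_diagop /diag_entry mcoeffA mcoeff_tensX !eqxx mulr1.
(* Nonnegativity of [lam] turns the positivity test of [diag_ginv] into a test for being nonzero. *)
by rewrite lt_def lam_ge0 andbT; case: eqP.
Qed.

Let AG u : A (diag_ginv A u) = u - P u.
Proof.
apply/spinorP => k S; rewrite mcoeffA mcoeffG !ffunE mcoeffB mcoeff_diagop.
have [->|l0] := eqVneq (lam k S) 0; first by rewrite !mul0r mul1r subrr.
by rewrite mulrA divff // mul1r mul0r subr0.
Qed.

Let GA u : diag_ginv A (A u) = u - P u.
Proof.
rewrite -AG; apply/spinorP => k S.
by rewrite mcoeffA !mcoeffG mcoeffA mulrCA.
Qed.

Let P_eq0 (u : spinor K m) : (forall k S, lam k S = 0 -> (u S)@_k = 0) <-> P u = 0.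
Proof.
rewrite -spinorP; split=> u0 k S.
  rewrite mcoeff_diagop ffunE mcoeff0.
  by case: eqP => [/u0->|_]; rewrite ?mulr0 ?mul0r.
move=> kS; have := u0 k S.
by rewrite mcoeff_diagop kS eqxx mul1r ffunE mcoeff0.
Qed.

Let Pd0 u : P (d u) = 0. Proof. by apply/P_eq0 => k S; apply: mcoeff_d. Qed.
Let PZ0 u : P (Z u) = 0. Proof. by apply/P_eq0 => k S; apply: mcoeff_Z. Qed.

Let dP0 u : d (P u) = 0.
Proof.
rewrite linear_sum big1 // => S _; rewrite linear_sum big1 // => k _.
rewrite !linearZ /=; case: eqP => [/d_tens->|_]; last by rewrite scale0r.
by rewrite !scaler0.
Qed.

(** By the coefficient criteria [lspan_tensX] and [P_eq0], this span is the kernel of [P]. *)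
Lemma contracts_on_diag_ginv :
  contracts_on
    (lspan (fun u : spinor K m => exists k S, lam k S != 0 /\ u = tens 'X_[k] S))
    d (fun u => Z (diag_ginv A u)).
Proof.
apply: (contracts_on_ginv dd0 AG GA Pd0 dP0) => // u.
rewrite -P_eq0 (lspan_tensX (fun k S => lam k S == 0)).
by split=> u0 k S /eqP; apply: u0.
Qed.

(** The two hypotheses match the images under [f] of monomials with the basis vectors of eigenvalue
    zero, so [f] and [P] have the same range. *)
Lemma represents_cohomology_diag (f : {linear {mpoly K[m]} -> spinor K m}) :
    (forall b, exists k S, lam k S = 0 /\ f 'X_[b] = tens 'X_[k] S) ->
    (forall k S, lam k S = 0 -> exists b, f 'X_[b] = tens 'X_[k] S) ->
  represents_cohomology f d.
Proof.
move=> fX Xf.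
apply: (represents_cohomology_ginv dd0 AG GA Pd0 dP0) => [p|u].
  apply/spinorP => l T; rewrite mcoeff_diagop.
  case: eqP => [_|lT]; first by rewrite mul1r.
  rewrite mul0r (mpolyE p) linear_sum sum_ffunE raddf_sum big1 //= => b _.
  have [k [S [kS fb]]] := fX b.
  rewrite linearZ /= fb ffunE mcoeffZ mcoeff_tensX.
  case: eqP => [E|_]; rewrite ?mulr0 //; case: eqP => [E'|_]; rewrite ?mulr0 //.
  by rewrite -E E' in lT.
apply: rpred_sum => S _; apply: rpred_sum => k _.
case: eqP => [/Xf[b <-]|_]; last by rewrite scale0r rpred0.
by rewrite scale1r rpredZ // unfold_in; apply/asboolP; exists 'X_[b].
Qed.

End DiagonalHomotopy.

(** * Anticommutation in the exterior algebra *)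

Section ExteriorFamilies.
Variables (K : fieldType) (m : nat).
Implicit Types (u : spinor K m) (i j : 'I_m) (k : 'X_{1..m + m}) (S : {set 'I_m}).

Lemma Zop_is_linear : linear (@Zop K m).
Proof.
move=> a u v; rewrite /Zop scaler_sumr -big_split /=.
by apply: eq_bigr => i _; rewrite !linearP.
Qed.
HB.instance Definition _ :=
  GRing.isLinear.Build K (spinor K m) (spinor K m) _ (@Zop K m) Zop_is_linear.

Lemma Zopd_is_linear : linear (@Zopd K m).
Proof.
move=> a u v; rewrite /Zopd scaler_sumr -big_split /=.
by apply: eq_bigr => i _; rewrite !linearP.
Qed.
HB.instance Definition _ :=
  GRing.isLinear.Build K (spinor K m) (spinor K m) _ (@Zopd K m) Zopd_is_linear.

Lemma signr_ltnC i j : i != j ->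
  (-1) ^+ (i < j)%N = - (-1) ^+ (j < i)%N :> K.
Proof.
move=> ij; have: nat_of_ord i != j by [].
by case: ltngtP => // _ _; rewrite expr0 expr1 ?opprK.
Qed.

(** Pulling [j] out of the sign of [i], and [i] out of the sign of [j], leaves the same product
    times $(-1)^{[j<i]}$ in one order and $(-1)^{[i<j]}$ in the other. *)
Lemma wedge_anticomm i j u : wedge i (wedge j u) = - wedge j (wedge i u).
Proof.
apply/ffunP => T; rewrite !ffunE !inE.
have [<-|ij] /= := eqVneq i j; first by case: ifP; rewrite ?scaler0 oppr0.
case: (boolP (i \in T)) => iT; case: (boolP (j \in T)) => jT;
  rewrite ?scaler0 ?oppr0 //.
rewrite !scalerA setDDl setUC -setDDl.
rewrite (wedge_signD1 _ i jT) (wedge_signD1 _ j iT) (signr_ltnC ij).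
by rewrite -scaleNr; congr (_ *: _); ring.
Qed.

Lemma contr_anticomm i j u : contr i (contr j u) = - contr j (contr i u).
Proof.
apply/ffunP => T; rewrite !ffunE !inE.
have [<-|ij] /= := eqVneq i j; first by case: ifP; rewrite ?scaler0 oppr0.
case: (boolP (i \in T)) => iT; case: (boolP (j \in T)) => jT;
  rewrite ?scaler0 ?oppr0 //.
rewrite !scalerA setUCA.
rewrite (wedge_signD1 _ j (setU11 i T)) (wedge_signD1 _ i (setU11 j T)).
rewrite !setU1K // (signr_ltnC ij).
by rewrite -scaleNr; congr (_ *: _); ring.
Qed.

Lemma act_comm (f g : {mpoly K[m + m]} -> {mpoly K[m + m]}) u :
  (forall p, f (g p) = g (f p)) -> act f (act g u) = act g (act f u).
Proof. by move=> fg; apply/ffunP => T; rewrite !ffunE. Qed.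

(** Commuting polynomial factors and anticommuting exterior factors give the hypothesis of
    [anticomm_sum_sq0]. *)
Lemma wedge_act_anticomm (f g : {linear {mpoly K[m + m]} -> {mpoly K[m + m]}})
    i j u :
  (forall p, f (g p) = g (f p)) ->
  wedge i (act f (wedge j (act g u))) = - wedge j (act g (wedge i (act f u))).
Proof. by move=> fg; rewrite !act_wedge wedge_anticomm (act_comm _ fg). Qed.

Lemma contr_act_anticomm (f g : {linear {mpoly K[m + m]} -> {mpoly K[m + m]}})
    i j u :
  (forall p, f (g p) = g (f p)) ->
  contr i (act f (contr j (act g u))) = - contr j (act g (contr i (act f u))).
Proof. by move=> fg; rewrite !act_contr contr_anticomm (act_comm _ fg). Qed.

Lemma tens0 S : tens (0 : {mpoly K[m + m]}) S = 0.
Proof. by apply/ffunP => T; rewrite !ffunE mul0rn. Qed.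

End ExteriorFamilies.

(** * Coefficients of $q$-derivatives *)

Section QCalculus.
Variables (K : fieldType) (n : nat).
Implicit Types (p : {mpoly K[n]}) (x y : 'I_n) (k : 'X_{1..n}).

Lemma mcoeff_qderiv q x p k :
  (qderiv q x p)@_k = (q - 1)^-1 * ((q ^+ (k x).+1 - 1) * p@_(k + U_(x))).
Proof.
rewrite mcoeffZ mcoeff_mdivX mcoeffB mcoeff_mdil mnmDE mnm1E eqxx addn1.
by rewrite mulrBl mul1r.
Qed.

(** For distinct variables, the shift in one leaves the exponent of the other unchanged, so both
    orders produce the same factors in each coefficient. *)
Lemma qderivC q x y p : qderiv q x (qderiv q y p) = qderiv q y (qderiv q x p).
Proof.
have [->//|xy] := eqVneq x y.
apply/mpolyP => k; rewrite !mcoeff_qderiv !mnmDE !mnm1E (negPf xy) [y == x]eq_sym.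
rewrite (negPf xy) !addn0 -!addmA [(U_(x) + _)%MM]addmC; ring.
Qed.

Lemma qderivX_eq0 q x k : q != 1 -> k x = 0%N -> qderiv q x 'X_[K, k] = 0.
Proof. by move=> q1 kx; rewrite qderivX // kx /qnum subrr mul0r scale0r. Qed.

Lemma mcoeffXM_eq0 x p k : k x = 0%N -> ('X_x * p)@_k = 0.
Proof.
move=> kx; rewrite [p]mpolyE mulr_sumr raddf_sum big1 // => l _ /=.
rewrite -scalerAr -mpolyXD mcoeffZ mcoeffX; case: eqP => [E|]; last by rewrite mulr0.
by move: kx; rewrite -E mnmDE mnm1E eqxx.
Qed.

End QCalculus.

(** * Pairs of exponents and multidegrees in all $2m$ variables *)

Section Multidegrees.
Variables (K : fieldType) (m : nat).
Implicit Types (a b : 'X_{1..m}) (k : 'X_{1..m + m}) (S : {set 'I_m}).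

(** The basis is indexed by $(\alpha,\beta)$, whereas eigenvalues are computed on ['X_[k]] with a
    single multidegree [k]; this translates between the two. *)
Definition mnmcat a b : 'X_{1..m + m} :=
  [multinom match split x with inl i => a i | inr i => b i end | x < m + m].

Lemma mnmcat_lshift a b i : mnmcat a b (lshift m i) = a i.
Proof. by rewrite mnmE (unsplitK (inl i)). Qed.

Lemma mnmcat_rshift a b i : mnmcat a b (rshift m i) = b i.
Proof. by rewrite mnmE (unsplitK (inr i)). Qed.

Lemma mnmcatK k :
  mnmcat [multinom k (lshift m i) | i < m] [multinom k (rshift m i) | i < m] = k.
Proof.
by apply/mnmP => x; case: (split_ordP x) => i ->;
  rewrite ?mnmcat_lshift ?mnmcat_rshift mnmE.
Qed.

Lemma mpolyX_mnmcat a b :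
  'X_[mnmcat a b] =
  (\prod_i 'X_(lshift m i) ^+ a i) * (\prod_i 'X_(rshift m i) ^+ b i)
    :> {mpoly K[m + m]}.
Proof.
rewrite mpolyXE_id big_split_ord; congr (_ * _); apply: eq_bigr => i _.
  by rewrite mnmcat_lshift.
by rewrite mnmcat_rshift.
Qed.

Lemma zweE a b S : zwe K a b S = tens 'X_[mnmcat a b] S.
Proof. by rewrite mpolyX_mnmcat. Qed.

Lemma wvacX b : @wvac K m 'X_[b] = tens 'X_[mnmcat 0 b] set0.
Proof.
rewrite /wvac mpolyX_mnmcat comp_mpolyX [X in _ = tens (X * _) _]big1 => [|i _].
  by rewrite mul1r; congr tens; apply: eq_bigr => i _; rewrite tnth_mktuple.
by rewrite mnm0E expr0.
Qed.

Lemma ztopX a : @ztop K m 'X_[a] = tens 'X_[mnmcat a 0] setT.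
Proof.
rewrite /ztop mpolyX_mnmcat comp_mpolyX [X in _ = tens (_ * X) _]big1 => [|i _].
  by rewrite mulr1; congr tens; apply: eq_bigr => i _; rewrite tnth_mktuple.
by rewrite mnm0E expr0.
Qed.

End Multidegrees.

(** * The complexes of $\mathcal D_q$ and $\mathcal D_q^\dagger$ *)

Section Spinors.
Variables (K : numFieldType) (m : nat) (q : K).
Hypotheses (q_gt0 : 0 < q) (q_lt1 : q < 1).
Implicit Types (u : spinor K m) (k : 'X_{1..m + m}) (S : {set 'I_m}).

Let q_neq1 : q != 1. Proof. by rewrite lt_eqF. Qed.

Lemma sum_qnum_ge0 (r : 'I_m -> nat) : 0 <= \sum_i qnum q (r i).
Proof. by apply: sumr_ge0 => i _; apply: qnum_ge0. Qed.

Lemma sum_qnum_eq0 (r : 'I_m -> nat) :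
  \sum_i qnum q (r i) = 0 <-> forall i, r i = 0%N.
Proof.
split=> [/psumr_eq0P r0 i|r0].
  by apply/eqP; rewrite -(@qnum_eq0 _ q) // r0 // => j _; apply: qnum_ge0.
by apply: big1 => i _; apply/eqP; rewrite qnum_eq0 // r0.
Qed.

(** The exponents of $w$ do not enter the eigenvalue, which is why all polynomials in $w$ survive in
    the cohomology. *)
Lemma Aq_eigen_eq0 k S :
  \sum_i qnum q (k (lshift m i) + (i \in S)) = 0 <->
  (forall i, k (lshift m i) = 0%N) /\ S = set0.
Proof.
rewrite sum_qnum_eq0; split=> [kS|[k0 ->] i]; last by rewrite k0 inE.
split=> [i|]; first by have := kS i; lia.
by apply/setP => i; rewrite inE; have := kS i; case: (i \in S); rewrite // addn1.
Qed.

(** The indicator is that of the complement of [S], so vanishing terms force [S] to be full. *)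
Lemma Bq_eigen_eq0 k S :
  \sum_i qnum q (k (rshift m i) + (i \notin S)) = 0 <->
  (forall i, k (rshift m i) = 0%N) /\ S = setT.
Proof.
rewrite sum_qnum_eq0; split=> [kS|[k0 ->] i]; last by rewrite k0 inE.
split=> [i|]; first by have := kS i; lia.
by apply/setP => i; rewrite inE; have := kS i; case: (i \in S); rewrite // addn1.
Qed.

Lemma Dq_sq0 u : Dq q (Dq q u) = 0.
Proof.
pose D i := act (qderiv q (lshift m i)).
apply: (@anticomm_sum_sq0 _ _ _ (fun i => wedge i \o D i)) => i j v.
by apply: wedge_act_anticomm => p; apply: qderivC.
Qed.

Lemma Dqd_sq0 u : Dqd q (Dqd q u) = 0.
Proof.
pose D i := act (qderiv q (rshift m i)).
apply: (@anticomm_sum_sq0 _ _ _ (fun i => contr i \o D i)) => i j v.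
by apply: contr_act_anticomm => p; apply: qderivC.
Qed.

(** Exterior multiplication raises the degree, so nothing lands in degree 0; this yields $P\mathcal
    D_q=0$. *)
Lemma mcoeff_Dq0 u k : (Dq q u set0)@_k = 0.
Proof. by rewrite sum_ffunE big1 ?mcoeff0 // => i _; rewrite ffunE inE. Qed.

(** Contraction lowers the degree, so the top degree is never reached. *)
Lemma mcoeff_DqdT u k : (Dqd q u setT)@_k = 0.
Proof. by rewrite sum_ffunE big1 ?mcoeff0 // => i _; rewrite ffunE inE. Qed.

(** Every term of [Zop] is a multiple of some $z_i$; this yields $P\mathcal Z=0$. *)
Lemma mcoeff_Zop_eq0 u k S :
  (forall i, k (lshift m i) = 0%N) -> (Zop u S)@_k = 0.
Proof.
move=> k0; rewrite sum_ffunE raddf_sum big1 // => i _ /=; rewrite !ffunE.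
by case: ifP => _; rewrite ?mcoeff0 // mcoeffZ mcoeffXM_eq0 ?mulr0.
Qed.

Lemma mcoeff_Zopd_eq0 u k S :
  (forall i, k (rshift m i) = 0%N) -> (Zopd u S)@_k = 0.
Proof.
move=> k0; rewrite sum_ffunE raddf_sum big1 // => i _ /=; rewrite !ffunE.
by case: ifP => _; rewrite ?mcoeff0 // mcoeffZ mcoeffXM_eq0 ?mulr0.
Qed.

(** Monomials free of $z$ are constants for the $q$-derivatives in $z$; this yields $\mathcal
    D_qP=0$. *)
Lemma Dq_tens_eq0 k S :
  (forall i, k (lshift m i) = 0%N) -> Dq q (tens 'X_[k] S) = 0.
Proof.
move=> k0; apply: big1 => i _.
by rewrite act_tens /= qderivX_eq0 // tens0 linear0.
Qed.

Lemma Dqd_tens_eq0 k S :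
  (forall i, k (rshift m i) = 0%N) -> Dqd q (tens 'X_[k] S) = 0.
Proof.
move=> k0; apply: big1 => i _.
by rewrite act_tens /= qderivX_eq0 // tens0 linear0.
Qed.

Lemma Dq_contraction :
  contracts_on
    (lspan (fun u : spinor K m => exists a b S,
       (a, S) <> (0%MM, set0) /\ u = zwe K a b S))
    (Dq q) (fun u => Zop (diag_ginv (Aq q) u)) /\
  represents_cohomology (@wvac K m) (@Dq K m q).
Proof.
pose lam k S := \sum_i qnum q (k (lshift m i) + (i \in S)).
have lam0 k S : lam k S = 0 -> (forall i, k (lshift m i) = 0%N) /\ S = set0.
  by move/Aq_eigen_eq0.
have lam_ge0 k S : 0 <= lam k S := sum_qnum_ge0 _.
have A_lam := @Aq_diag K m q q_neq1 : forall k S, _ = lam k S *: _.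
have mcoeff_d u k S : lam k S = 0 -> (Dq q u S)@_k = 0.
  by move=> /lam0[_ ->]; apply: mcoeff_Dq0.
have mcoeff_Z u k S : lam k S = 0 -> (Zop u S)@_k = 0.
  by move=> /lam0[k0 _]; apply: mcoeff_Zop_eq0.
have d_tens k S : lam k S = 0 -> Dq q (tens 'X_[k] S) = 0.
  by move=> /lam0[k0 _]; apply: Dq_tens_eq0.
split.
  (* The excluded pairs are those of eigenvalue zero, so the span can be reindexed by
     multidegrees. *)
  rewrite (_ : (fun u => exists a b S, _) =
    (fun u => exists k S, lam k S != 0 /\ u = tens 'X_[k] S)).
    exact: (contracts_on_diag_ginv lam_ge0 Dq_sq0 A_lam mcoeff_d mcoeff_Z d_tens).
  apply/funext => u; apply/propext; split=> [[a [b [S [aS ->]]]]|[k [S [kS ->]]]].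
    exists (mnmcat a b), S; rewrite zweE; split=> //.
    apply/eqP => /lam0[k0 S0]; apply: aS; congr (_, _) => //.
    by apply/mnmP => i; rewrite mnm0E -(k0 i) mnmcat_lshift.
  exists [multinom k (lshift m i) | i < m], [multinom k (rshift m i) | i < m], S.
  rewrite zweE mnmcatK; split=> // /pair_equal_spec[k0 S0]; case/eqP: kS.
  apply/Aq_eigen_eq0; split=> // i.
  by have := congr1 (fun a : 'X_{1..m} => a i) k0; rewrite mnmE mnm0E.
apply: (represents_cohomology_diag lam_ge0 Dq_sq0 A_lam mcoeff_d d_tens).
  move=> b; exists (mnmcat 0 b), set0; split; last exact: wvacX.
  by apply/Aq_eigen_eq0; split=> // i; rewrite mnmcat_lshift mnm0E.
(* The $z$-part of [k] vanishes, so [k] is recovered from its $w$-part. *)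
move=> k S /lam0[k0 ->]; exists [multinom k (rshift m i) | i < m].
rewrite [LHS]wvacX -[in RHS](mnmcatK k); congr (tens 'X_[mnmcat _ _] _).
by apply/mnmP => i; rewrite mnm0E mnmE.
Qed.

(** The mirror argument: $z$ and $w$, wedge and contraction, [S] and its complement trade places. *)
Lemma Dqd_contraction :
  contracts_on
    (lspan (fun u : spinor K m => exists a b S,
       (b, S) <> (0%MM, setT) /\ u = zwe K a b S))
    (Dqd q) (fun u => Zopd (diag_ginv (Bq q) u)) /\
  represents_cohomology (@ztop K m) (@Dqd K m q).
Proof.
pose lam k S := \sum_i qnum q (k (rshift m i) + (i \notin S)).
have lam0 k S : lam k S = 0 -> (forall i, k (rshift m i) = 0%N) /\ S = setT.
  by move/Bq_eigen_eq0.
have lam_ge0 k S : 0 <= lam k S := sum_qnum_ge0 _.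
have A_lam := @Bq_diag K m q q_neq1 : forall k S, _ = lam k S *: _.
have mcoeff_d u k S : lam k S = 0 -> (Dqd q u S)@_k = 0.
  by move=> /lam0[_ ->]; apply: mcoeff_DqdT.
have mcoeff_Z u k S : lam k S = 0 -> (Zopd u S)@_k = 0.
  by move=> /lam0[k0 _]; apply: mcoeff_Zopd_eq0.
have d_tens k S : lam k S = 0 -> Dqd q (tens 'X_[k] S) = 0.
  by move=> /lam0[k0 _]; apply: Dqd_tens_eq0.
split.
  rewrite (_ : (fun u => exists a b S, _) =
    (fun u => exists k S, lam k S != 0 /\ u = tens 'X_[k] S)).
    exact: (contracts_on_diag_ginv lam_ge0 Dqd_sq0 A_lam mcoeff_d mcoeff_Z d_tens).
  apply/funext => u; apply/propext; split=> [[a [b [S [bS ->]]]]|[k [S [kS ->]]]].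
    exists (mnmcat a b), S; rewrite zweE; split=> //.
    apply/eqP => /lam0[k0 ST]; apply: bS; congr (_, _) => //.
    by apply/mnmP => i; rewrite mnm0E -(k0 i) mnmcat_rshift.
  exists [multinom k (lshift m i) | i < m], [multinom k (rshift m i) | i < m], S.
  rewrite zweE mnmcatK; split=> // /pair_equal_spec[k0 ST]; case/eqP: kS.
  apply/Bq_eigen_eq0; split=> // i.
  by have := congr1 (fun b : 'X_{1..m} => b i) k0; rewrite mnmE mnm0E.
apply: (represents_cohomology_diag lam_ge0 Dqd_sq0 A_lam mcoeff_d d_tens).
  move=> a; exists (mnmcat a 0), setT; split; last exact: ztopX.
  by apply/Bq_eigen_eq0; split=> // i; rewrite mnmcat_rshift mnm0E.
move=> k S /lam0[k0 ->]; exists [multinom k (lshift m i) | i < m].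
rewrite [LHS]ztopX -[in RHS](mnmcatK k); congr (tens 'X_[mnmcat _ _] _).
by apply/mnmP => i; rewrite mnm0E mnmE.
Qed.

End Spinors.

Theorem corollary3p4 (R : realType) (m : nat) (q : R)
    (hm : (1 <= m)%N) (hq0 : 0 < q) (hq1 : q < 1) :
  [/\ contracts_on
        (lspan (fun u : spinor R[i] m => exists a b S,
           (a, S) <> (0%MM, set0) /\ u = zwe R[i] a b S))
        (Dq q%:C%C)
        (fun u => Zop (diag_ginv (Aq q%:C%C) u)),
      contracts_on
        (lspan (fun u : spinor R[i] m => exists a b S,
           (b, S) <> (0%MM, setT) /\ u = zwe R[i] a b S))
        (Dqd q%:C%C)
        (fun u => Zopd (diag_ginv (Bq q%:C%C) u)),
      represents_cohomology (@wvac R[i] m) (@Dq R[i] m q%:C%C) &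
      represents_cohomology (@ztop R[i] m) (@Dqd R[i] m q%:C%C)].
Proof.
(* The order of [R[i]] extends that of [R], so the results over a [numFieldType] apply. *)
have q_gt0 : 0 < q%:C%C by rewrite ltcR.
have q_lt1 : q%:C%C < 1 by rewrite ltcR.
have [contrD cohD] := Dq_contraction m q_gt0 q_lt1.
by have [contrDd cohDd] := Dqd_contraction m q_gt0 q_lt1.
Qed.
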